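(* Let $G$ be a complex Banach--Lie group and $P\subseteq G$ a complex Lie subgroup. Let $W$ be a representation of $G$ on a complex locally convex space with holomorphic orbit maps, and let $(\rho,E)$ be a representation of $P$ on a complex locally convex space with holomorphic orbit maps. Then the map $$\mathrm{Hom}_G(W,\mathcal O_\rho(G,E))\to\mathrm{Hom}_P(W,E),\qquad \varphi\mapsto \mathrm{ev}_{\mathbf 1}\circ\varphi,$$ is a bijection, where $\mathrm{Hom}_P$ denotes the set of continuous (linear) $P$-morphisms and $\mathrm{Hom}_G$ denotes the set of those (linear) $G$-morphisms that are continuous with respect to the topology of pointwise convergence on $\mathcal O_\rho(G,E)$. Its inverse is given by $$\mathrm{Hom}_P(W,E)\to\mathrm{Hom}_G(W,\mathcal O_\rho(G,E)),\qquad \beta\mapsto\beta_G,\qquad \beta_G(w)(g)=\beta(g^{-1}.w).$$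
   Context: Representations on locally convex spaces are by continuous linear operators; ''holomorphic orbit maps'' means that for each $w\in W$ the map $G\to W$, $g\mapsto g.w$, is holomorphic (similarly $P\to E$, $p\mapsto\rho(p)v$ for $v\in E$). $\mathcal O_\rho(G,E)=\{f:G\to E\text{ holomorphic}: f(gp)=\rho(p)^{-1}f(g)\ \forall g\in G,\ p\in P\}$, on which $G$ acts by $(g.f)(x)=f(g^{-1}x)$. $\mathrm{ev}_{\mathbf 1}(f)=f(\mathbf 1)$, where $\mathbf 1$ is the identity element of $G$. *)

(* Defs.v *)
From HB Require Import structures.
From mathcomp Require Import all_boot all_order all_algebra.
From mathcomp Require Import complex.
From mathcomp Require Import all_classical all_reals topology normedtype.
Set Implicit Arguments.
Unset Strict Implicit.
Unset Printing Implicit Defensive.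
Import Order.TTheory GRing.Theory Num.Theory.
Local Open Scope classical_set_scope.
Local Open Scope ring_scope.
Local Open Scope complex_scope.

Section HolomorphicMaps.
Context {R : realType} {V F : tvsType R[i]}.
Implicit Types (S A : set V) (f : V -> F).

(* Holomorphy of [f] on a relatively open subset [A] of the linear subspace
   [S] of [V], regarded as a locally convex space of its own: [f] is C^1 in the
   sense of Michal-Bastiani (the directional derivatives
   [df x v = lim_(t -> 0) (f (x + t v) - f x) / t], for [x] in [A] and [v] in
   [S], exist and are jointly continuous in [(x, v)]) and every [df x] is
   complex linear. Only the values of [f] on [A] matter. *)
Definition holomorphic_along S A f : Prop :=
  {within A, continuous f} /\
  exists df : V -> V -> F,
    [/\ forall x v, A x -> S v ->
          (fun t : R[i]^o => t^-1 *: (f (x + t *: v) - f x)) @ 0^' --> df x v,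
        {within A `*` S, continuous (fun z : V * V => df z.1 z.2)}
      & forall x, A x -> forall (a : R[i]) u v, S u -> S v ->
          df x (a *: u + v) = a *: df x u + df x v].

Definition holomorphic_on A f : Prop := holomorphic_along setT A f.

Definition closed_subspace S : Prop :=
  [/\ closed S, S 0
    & forall (a : R[i]) u v, S u -> S v -> S (a *: u + v)].

End HolomorphicMaps.

Section Charts.
Context {R : realType}.
Implicit Types (V : completeNormedModType R[i]) (G : topologicalType).

(* Junk values are allowed for [chart_map] outside [chart_dom] and for
   [chart_inv] outside [chart_img]. *)
Record chart V G := Chart {
  chart_dom : set G;
  chart_map :> G -> V;
  chart_inv : V -> G;
  chart_dom_open : open chart_dom;
  chart_img_open : open (chart_map @` chart_dom);
  chart_mapK : forall x, chart_dom x -> chart_inv (chart_map x) = x;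
  chart_map_continuous : {within chart_dom, continuous chart_map};
  chart_inv_continuous :
    {within chart_map @` chart_dom, continuous chart_inv}
}.

Definition chart_img V G (c : chart V G) : set V := c @` chart_dom c.

Definition holomorphic_transition V G (c d : chart V G) : Prop :=
  holomorphic_on (c @` (chart_dom c `&` chart_dom d)) (d \o chart_inv c).

End Charts.

Local Open Scope group_scope.

(* All connected components of a Banach-Lie group have, by translation, the
   same model space; hence a single space [V] for the whole atlas. *)
HB.mixin Record isComplexBanachLieGroup (R : realType)
    (V : completeNormedModType R[i]) G of Topological G & Group G := {
  lie_hausdorff : hausdorff_space G;
  lie_atlas : set (chart V G);
  lie_atlas_cover : forall g : G, exists2 c, lie_atlas c & chart_dom c g;
  lie_atlas_compatible : forall c d, lie_atlas c -> lie_atlas d ->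
    holomorphic_transition c d;
  lie_mul_continuous : continuous (fun z : G * G => z.1 * z.2);
  lie_mul_holomorphic : forall a b c,
    lie_atlas a -> lie_atlas b -> lie_atlas c ->
    holomorphic_on
      [set z : V * V | [/\ chart_img a z.1, chart_img b z.2
                         & chart_dom c (chart_inv a z.1 * chart_inv b z.2)]]
      (fun z : V * V => c (chart_inv a z.1 * chart_inv b z.2));
  lie_inv_continuous : continuous (fun g : G => g^-1);
  lie_inv_holomorphic : forall a c, lie_atlas a -> lie_atlas c ->
    holomorphic_on
      [set x : V | chart_img a x /\ chart_dom c (chart_inv a x)^-1]
      (fun x : V => c (chart_inv a x)^-1)
}.

#[short(type="complexBanachLieGroupType")]
HB.structure Definition ComplexBanachLieGroup (R : realType)
    (V : completeNormedModType R[i]) :=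
  {G of isComplexBanachLieGroup R V G & Topological G & Group G}.

Section LieSubgroups.
Context {R : realType} {V : completeNormedModType R[i]}
  {G : complexBanachLieGroupType V}.
Implicit Types (P : set G) (c : chart V G).

(* membership in the maximal atlas *)
Definition holomorphic_chart c : Prop := forall a, lie_atlas a ->
  holomorphic_transition a c /\ holomorphic_transition c a.

Definition submanifold_chart P c (S : set V) : Prop :=
  [/\ holomorphic_chart c, closed_subspace S
    & c @` (chart_dom c `&` P) = chart_img c `&` S].

(* The model space [S] is not required to be complemented in [V]. *)
Definition complex_lie_subgroup P : Prop :=
  [/\ P 1,
      forall g h, P g -> P h -> P (g * h^-1)
    & forall p, P p -> exists c S, chart_dom c p /\ submanifold_chart P c S].

Definition holomorphic_fun {E : tvsType R[i]} (f : G -> E) : Prop :=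
  forall c, lie_atlas c -> holomorphic_on (chart_img c) (f \o chart_inv c).

(* Holomorphy of the restriction of [f] to the complex manifold [P]. *)
Definition holomorphic_fun_on P {E : tvsType R[i]} (f : G -> E) : Prop :=
  forall c S, submanifold_chart P c S ->
    holomorphic_along S (c @` (chart_dom c `&` P)) (f \o chart_inv c).

End LieSubgroups.

Section Representations.
Context {R : realType} {V : completeNormedModType R[i]}
  {G : complexBanachLieGroupType V}.
Implicit Types (P : set G) (W E : tvsType R[i]).

(* A representation of the subgroup [P]; the operators [rho g] with [g] outside
   [P] are junk values. *)
Definition representation P E (rho : G -> E -> E) : Prop :=
  [/\ forall p, P p -> linear (rho p) /\ continuous (rho p),
      forall v, rho 1 v = v
    & forall p q v, P p -> P q -> rho (p * q) v = rho p (rho q v)].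

(* $\mathcal O_\rho(G,E)$; here $\rho(p)^{-1}=\rho(p^{-1})$ *)
Definition holomorphic_sections P E (rho : G -> E -> E) : set (G -> E) :=
  [set f | holomorphic_fun f /\
           forall g p, P p -> f (g * p) = rho p^-1 (f g)].

Definition translate E (g : G) (f : G -> E) : G -> E := fun x => f (g^-1 * x).

Definition Hom_P P W E (pi : G -> W -> W) (rho : G -> E -> E) :
    set (W -> E) :=
  [set beta | [/\ linear beta, continuous beta
    & forall p w, P p -> beta (pi p w) = rho p (beta w)]].

Definition Hom_G P W E (pi : G -> W -> W) (rho : G -> E -> E) :
    set (W -> G -> E) :=
  [set phi | [/\ forall w, holomorphic_sections P rho (phi w),
      linear phi,
      continuous (phi : W -> {ptws G -> E})
    & forall g w, phi (pi g w) = translate g (phi w)]].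

Definition ev1 W E (phi : W -> G -> E) : W -> E := fun w => phi w 1.

(* $\beta\mapsto\beta_G$ *)
Definition coinduce W E (pi : G -> W -> W) (beta : W -> E) : W -> G -> E :=
  fun w g => beta (pi g^-1 w).

End Representations.

(* Main.v *)
Require Import Defs.
From mathcomp Require Import all_boot all_order all_algebra.
From mathcomp Require Import complex.
From mathcomp Require Import all_classical all_reals topology normedtype convex.
From mathcomp Require Import interval_inference.
Set Implicit Arguments.
Unset Strict Implicit.
Import Order.TTheory GRing.Theory Num.Theory.
Local Open Scope classical_set_scope.
Local Open Scope ring_scope.
Local Open Scope complex_scope.

(** The bijection itself is formal. Writing [beta = ev1 phi], equivariance gives
    [phi w g = (g^-1 . phi w) 1 = phi (pi g^-1 w) 1 = beta (pi g^-1 w)], so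
    [phi] is recovered from [beta] ([coinduceK]). Since [pi 1] is the identity,
    [beta] is recovered from [coinduce pi beta] ([ev1_coinduce]). Equivariance
    of [beta] under [P] matches the transformation law of the sections under
    right translation by [P].

    The analytic content is that [g |-> beta (pi g^-1 w)] is holomorphic for a
    continuous linear [beta]. It is the composite of the inversion of [G], of
    the orbit map of [w] and of [beta], so a chain rule is needed
    ([holomorphic_on_comp]) for maps that are C^1 only in the directional sense
    of Michal and Bastiani. Along a curve [x + t v] the inner map moves by
    [t q(t)] with a direction [q(t)] that varies with [t], while the outer map
    [g] is only known to be differentiable along fixed directions. The gap is
    closed by [diff_quotient_joint]: the difference quotient of [g] at [y] in
    the direction [v], with step [t], converges to [dg y u] as [(t, v)] tends
    to [(0, u)]. By joint continuity, the derivatives [dg x v] at the points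
    [x] of the segment from [y] to [y + t v] all lie in a given convex
    neighborhood of [dg y u], and then so does the difference quotient
    ([convex_mean_value]). This is where local convexity of the target enters.

    The chain rule is applied near each point of a chart domain, with a chart
    adapted to the inverse of that point. The local pieces are glued by
    [holomorphic_on_local]. *)

(** * Mean value theorem in a locally convex space *)

Lemma convex_nbhs {R : realType} {F : tvsType R[i]} (e : F) (N : set F) :
  nbhs e N -> exists M : set F, [/\ open M, M e, M `<=` N
    & forall a b (l : R), M a -> M b -> 0 <= l -> l <= 1 ->
        M (l%:C *: a + (1 - l)%:C *: b)].
Proof.
have [B Bconv [Bopen Bbasis]] := @locally_convex _ F.
move=> /Bbasis [M [BM Me] MN]; exists M; split => //; first exact: Bopen.
move=> a b l Ma Mb l0 l1.
have /andP[lc0 lc1] : 0 <= l%:C <= 1 by rewrite !lecR l0 l1.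
have /= := @Bconv M (mem_set BM) a b (Itv01 lc0 lc1) (mem_set Ma) (mem_set Mb).
by rewrite inE rmorphB rmorph1.
Qed.

Lemma norm_realC {R : realType} (r : R) : `|r%:C| = `|r|%:C :> R[i].
Proof.
case: (ger0P r) => r0; first by rewrite ger0_norm ?(lecR 0).
by rewrite ltr0_norm ?(ltcR _ 0) ?rmorphN.
Qed.

Lemma nbhs0_complexP {R : realType} (P : set R[i]) :
  nbhs (0 : R[i]^o) (P : set R[i]^o) <->
  exists2 e : R, 0 < e & forall t : R[i], `|t| < e%:C -> P t.
Proof.
split=> [/(@nbhs_norm0P _ R[i]^o)[e /= e0 eP]|[e e0 eP]].
  have eE : (complex.Re e)%:C = e by apply: RRe_real; exact: gtr0_real.
  exists (complex.Re e); first by rewrite -ltcR eE.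
  by move=> t; rewrite eE => /eP.
apply/(@nbhs_norm0P _ R[i]^o); exists e%:C => //=; by rewrite (ltcR 0).
Qed.

Section MeanValue.
Context {R : realType} {F : tvsType R[i]}.

(** The hypothesis on [eta] says that its slopes from [s] to nearby points lie
    in [M]; a derivative at [s] interior to [M] provides this. By convexity,
    slopes in [M] over adjacent intervals give a slope in [M] over their union,
    so the set [S] of the [s] such that the slope from [0] to [s] lies in [M]
    contains its supremum and can be extended beyond any [s < 1]. *)
Lemma convex_mean_value (M : set F) (eta : R -> F) :
  (forall a b (l : R), M a -> M b -> 0 <= l -> l <= 1 ->
     M (l%:C *: a + (1 - l)%:C *: b)) ->
  (forall s, 0 <= s <= 1 -> exists2 e : R, 0 < e &
     forall r, r != s -> `|r - s| < e ->
       M ((r - s)^-1%:C *: (eta r - eta s))) ->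
  M (eta 1 - eta 0).
Proof.
move=> Mconv slope.
pose S := [set s : R | 0 <= s <= 1 /\
  (s = 0 \/ M (s^-1%:C *: (eta s - eta 0)))].
have S0 : S 0 by split; [rewrite lexx ler01 | left].
(* Adjacent intervals: the slope over [0, b] is the convex combination, with
   weights a / b and 1 - a / b, of the slopes over [0, a] and [a, b]. *)
have step a b : S a -> a < b -> b <= 1 ->
    M ((b - a)^-1%:C *: (eta b - eta a)) -> S b.
  move=> [/andP[a0 a1] Sa] ab b1 Mab.
  have b0 : 0 < b by exact: le_lt_trans ab.
  split; first by rewrite b1 ltW.
  right; case: Sa => [a_eq0|Ma]; first by move: Mab; rewrite a_eq0 subr0.
  have := Mconv _ _ (a / b) Ma Mab.
  rewrite divr_ge0 ?(ltW b0)// ler_pdivrMr// mul1r (ltW ab) => /(_ isT isT).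
  have [->|an0] := eqVneq a 0.
    by rewrite mul0r !rmorph0 scale0r add0r subr0 rmorph1 scale1r subr0.
  rewrite !scalerA -!rmorphM /=.
  have -> : a / b * a^-1 = b^-1 by rewrite mulrAC divff// mul1r.
  have -> : (1 - a / b) * (b - a)^-1 = b^-1.
    have bn0 : b != 0 by rewrite gt_eqF.
    by rewrite -(divff bn0) -mulrBl mulrAC divff ?mul1r// subr_eq0 gt_eqF.
  by rewrite -scalerDr [X in _ *: X]addrC subrKA.
have hS : has_sup S.
  by split; [exists 0 | exists 1 => s [/andP[]]].
have sup01 : 0 <= sup S <= 1.
  apply/andP; split; first exact: (ub_le_sup hS.2 S0).
  by apply: ge_sup; [exists 0 | move=> s [/andP[]]].
have [e e0 He] := slope _ sup01.
have Ssup : S (sup S).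
  have [a Sa ae] := sup_adherent e0 hS.
  have := ub_le_sup hS.2 Sa; rewrite le_eqVlt => /predU1P[<-//|asup].
  apply: (step _ _ Sa asup); first by case/andP: sup01.
  have := He a; rewrite lt_eqF// => /(_ isT).
  rewrite distrC gtr0_norm ?subr_gt0// ltrBlDl -ltrBlDr => /(_ ae).
  by rewrite -[a - _]opprB invrN rmorphN scaleNr -scalerN opprB.
have sup1 : sup S = 1.
  apply/eqP; rewrite eq_le; case/andP: (sup01) => _ -> /=.
  rewrite leNgt; apply/negP => lt1.
  pose b := Num.min 1 (sup S + e / 2).
  have supb : sup S < b by rewrite lt_min lt1 ltrDl divr_gt0.
  have : S b.
    apply: (step _ _ Ssup supb); first by rewrite ge_min lexx.
    apply: He; first by rewrite gt_eqF.
    rewrite gtr0_norm ?subr_gt0// ltrBlDl gt_min; apply/orP; right.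
    by rewrite ltrD2l ltr_pdivrMr// ltr_pMr// ltr1n.
  by move/(ub_le_sup hS.2); rewrite leNgt supb.
move: Ssup; rewrite sup1 => -[_ [/eqP|]]; first by rewrite oner_eq0.
by rewrite invr1 rmorph1 scale1r.
Qed.

End MeanValue.

(** * Holomorphic maps between locally convex spaces *)

Section Holomorphic.
Context {R : realType} {V F : tvsType R[i]}.

Definition diff_quotient (f : V -> F) (x v : V) (t : R[i]^o) : F :=
  t^-1 *: (f (x + t *: v) - f x).

(** On an open set the relative continuity conditions become pointwise ones. *)
Lemma holomorphic_onP (A : set V) (f : V -> F) : open A ->
  holomorphic_on A f <-> {in A, continuous f} /\
    exists df : V -> V -> F,
      [/\ forall x v, A x -> diff_quotient f x v @ 0^' --> df x v,
          forall x v, A x -> {for (x, v), continuous (fun z => df z.1 z.2)}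
        & forall x, A x -> linear (df x)].
Proof.
move=> oA; rewrite /holomorphic_on /holomorphic_along.
rewrite continuous_open_subspace//.
have oAT : open (A `*` [set: V]).
  rewrite openE => -[x v] [/= Ax _]; exists (A, setT) => //=.
  by split; [exact: open_nbhs_nbhs | exact: filterT].
split=> -[cf [df [D C L]]]; split => //; exists df; split.
- by move=> x v Ax; exact: D.
- move=> x v Ax; move: C; rewrite continuous_open_subspace// => C.
  by apply: C; rewrite inE.
- by move=> x Ax a u v; exact: L.
- by move=> x v Ax _; exact: D.
- rewrite continuous_open_subspace// => -[x v]; rewrite inE => -[Ax _].
  exact: C.
- by move=> x Ax a u v _ _; exact: L.
Qed.

Lemma continuous_line (x : V) :
  continuous (fun z : R[i]^o * V => x + z.1 *: z.2).
Proof.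
move=> z; apply: (@continuous_comp _ _ _
  (fun z : R[i]^o * V => (x, z.1 *: z.2)) (fun w : V * V => w.1 + w.2));
  last exact: add_continuous.
by apply: cvg_pair => /=; [exact: cvg_cst | exact: scale_continuous].
Qed.

Lemma near_line (x v : V) (N : set V) : nbhs x N ->
  \forall t \near (0 : R[i]^o)^', N (x + t *: v).
Proof.
rewrite -{1}[x]addr0 -(scale0r v) => /(@continuous_line x (0, v)).
move=> [[B1 B2] /= [nB1 nB2] BN]; apply: filterS nB1 => t Bt _.
exact: (BN (t, v) (conj Bt (nbhs_singleton nB2))).
Qed.

(** Here the direction may vary together with the step, whereas the hypothesis
    on [df] only concerns fixed directions. For [(t, v)] close to [(0, u)], the
    curve [eta s = t^-1 *: f (y + s t v)] has derivative [df (y + s t v) v] at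
    [s]: replacing the step [h] by [h t] cancels the factor [t^-1]. These
    derivatives lie in a convex neighborhood of [df y u], hence so does
    [eta 1 - eta 0], which is the difference quotient. *)
Lemma diff_quotient_joint (A : set V) (f : V -> F) (df : V -> V -> F) y u :
  open A ->
  (forall x v, A x -> diff_quotient f x v @ 0^' --> df x v) ->
  A y -> {for (y, u), continuous (fun z => df z.1 z.2)} ->
  (fun z : R[i]^o * V => diff_quotient f y z.2 z.1)
    @ within [set z | z.1 != 0] (nbhs ((0, u) : R[i]^o * V)) --> df y u.
Proof.
move=> oA D Ay C N /convex_nbhs[M [oM Me MN Mconv]].
have [[U U'] /= [nU nU'] UM] : nbhs (y, u) [set z | A z.1 /\ M (df z.1 z.2)].
  apply: filterI; last by apply: C; exact: open_nbhs_nbhs.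
  by apply: (cvg_fst (F := nbhs y)); exact: open_nbhs_nbhs.
have : nbhs ((0, u) : R[i]^o * V) [set z | U (y + z.1 *: z.2)].
  by apply: (@continuous_line y (0, u)); rewrite /= scale0r addr0.
move=> [[T U''] /= [/nbhs0_complexP[e e0 eT] nU''] TU].
exists ([set t : R[i] | `|t| < e%:C] : set R[i]^o, U' `&` U'') => /=.
  split; last exact: filterI.
  by apply/nbhs0_complexP; exists e.
move=> [t v] /= [te [U'v U''v]] t0; apply: MN.
have line s : 0 <= s <= 1 -> U (y + (s%:C * t) *: v).
  move=> /andP[s0 s1]; apply: (TU (_, v)); split => //; apply: eT.
  rewrite normrM ger0_norm ?lecR//; apply: le_lt_trans te.
  by rewrite ler_piMl// (lecR s 1).
pose eta (s : R) := t^-1 *: f (y + (s%:C * t) *: v).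
have := @convex_mean_value _ _ M eta Mconv.
rewrite /eta mul0r scale0r addr0 mul1r -scalerBr; apply.
move=> s /line Us; have [/= As Ms] := UM (_, v) (conj Us U'v).
have /(D _ v As) : nbhs (df (y + (s%:C * t) *: v) v) M.
  exact: open_nbhs_nbhs.
move=> /nbhs0_complexP[d d0 dM].
have q0 : 0 < d%:C / `|t : R[i]|.
  by apply: divr_gt0; [rewrite (ltcR 0) | rewrite normr_gt0].
have qE := RRe_real (gtr0_real q0).
(* If |r - s| < d' then the step (r - s) t has modulus less than d. *)
pose d' := complex.Re (d%:C / `|t : R[i]|).
have d'0 : 0 < d' by rewrite -ltcR qE.
have d'E : d'%:C * `|t : R[i]| = d%:C by rewrite qE divfK// normr_eq0.
exists d' => // r rs re.
have rs0 : (r - s)%:C != 0 :> R[i].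
  by rewrite (inj_eq (@complexI R) _ 0) subr_eq0.
have := dM ((r - s)%:C * t); rewrite normrM => /(_ _ _).
have rst : (r - s)%:C * (t : R[i]) != 0 by rewrite mulf_neq0.
rewrite norm_realC -d'E ltr_pM2r ?normr_gt0// ltcR => /(_ re rst).
rewrite /preimage /diff_quotient /= -addrA -scalerDl -mulrDl -rmorphD /=.
rewrite [s + _]addrC subrK -scalerBr scalerA.
by rewrite invfM -(fmorphV (real_complex R)).
Qed.

(** The derivative is glued by choosing, for each [x], a local model [g] on an
    open [B] around [x] and using its derivative at [x]. As [F] may fail to be
    separated, the derivatives of two local models need not agree at a common
    point. They are however limits of the same difference quotients, so each
    closed neighborhood of one contains the other, and [F] is regular; hence
    continuity is inherited from the model at the point considered. *)
Lemma holomorphic_on_local (A : set V) (f : V -> F) : open A ->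
  (forall x, A x -> exists B g, [/\ open B, B x, holomorphic_on B g
     & forall y, B y -> g y = f y]) ->
  holomorphic_on A f.
Proof.
move=> oA Hloc.
(* Bd x consists of the open set and of the derivative of a model at x. *)
have {}Hloc x : exists Bd : set V * (V -> V -> F), A x -> [/\ open Bd.1, Bd.1 x,
    {for x, continuous f},
    forall y v, Bd.1 y -> diff_quotient f y v @ 0^' --> Bd.2 y v
    & (forall y v, Bd.1 y -> {for (y, v), continuous (fun z => Bd.2 z.1 z.2)})
      /\ forall y, Bd.1 y -> linear (Bd.2 y)].
  have [Ax|nAx] := pselect (A x); last by exists (set0, fun=> fun=> 0).
  have [B [g [oB Bx hg gf]]] := Hloc x Ax.
  have [cg [dg [D C L]]] := (holomorphic_onP _ oB).1 hg.
  exists (B, dg) => _; split => //=.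
  - move=> N; rewrite /= -gf// => /(cg x (mem_set Bx)).
    apply: filterS2 (open_nbhs_nbhs (conj oB Bx)) => y /gf.
    by rewrite /preimage /= => ->.
  - move=> y v By N nN.
    have nB := near_line v (open_nbhs_nbhs (conj oB By)).
    have nD : \forall t \near (0 : R[i]^o)^', N (diff_quotient g y v t).
      exact: D nN.
    have : \forall t \near (0 : R[i]^o)^', N (diff_quotient f y v t).
      by apply: filterS2 nB nD => t Bt; rewrite /diff_quotient !gf.
    by [].
have /choice[Bd {}Hloc] := Hloc.
apply/holomorphic_onP => //; split.
  by move=> x /set_mem /Hloc[].
exists (fun x => (Bd x).2 x); split.
- by move=> x v /Hloc[_ Bx _ D _]; exact: D.
- move=> x v Ax; have [oB Bx _ D [C _]] := Hloc x Ax.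
  move=> N /= /uniform_regular[N' nN' N'N].
  have nA : nbhs (x, v) [set z : V * V | (A `&` (Bd x).1) z.1].
    apply: (cvg_fst (F := nbhs x)); apply: open_nbhs_nbhs.
    by split=> //; exact: openI.
  have := C x v Bx _ (nbhs_interior nN').
  apply: filterS2 nA => -[y w] /= [Ay By] N'y; apply: N'N => Q nQ.
  have [_ By' _ Dy _] := Hloc y Ay.
  have nQ0 : \forall t \near (0 : R[i]^o)^', Q (diff_quotient f y w t).
    exact: Dy nQ.
  have nN0 : \forall t \near (0 : R[i]^o)^', N' (diff_quotient f y w t).
    exact: D N'y.
  have [t [N't Qt]] := filter_ex (filterI nN0 nQ0).
  by exists (diff_quotient f y w t).
- by move=> x Ax; have [_ Bx _ _ [_ L]] := Hloc x Ax; exact: L.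
Qed.

End Holomorphic.

Lemma holomorphic_on_comp {R : realType} {V U F : tvsType R[i]}
    (A : set V) (B : set U) (f : V -> U) (g : U -> F) :
  open A -> open B -> (forall x, A x -> B (f x)) ->
  holomorphic_on A f -> holomorphic_on B g -> holomorphic_on A (g \o f).
Proof.
move=> oA oB fAB /(holomorphic_onP _ oA)[cf [df [Df Cf Lf]]].
move=> /(holomorphic_onP _ oB)[cg [dg [Dg Cg Lg]]].
apply/holomorphic_onP => //; split.
  move=> x /[dup] /set_mem Ax /cf cfx; apply: continuous_comp => //.
  by apply: cg; rewrite inE; exact: fAB.
exists (fun x v => dg (f x) (df x v)); split.
(* f (x + t v) = f x + t w, where w is the difference quotient of f. *)
- move=> x v Ax; have Bf := fAB _ Ax.
  move=> N /(diff_quotient_joint oB Dg Bf (Cg _ (df x v) Bf)).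
  move=> [[T W] /= [nT nW] TWN].
  have nD : \forall t \near (0 : R[i]^o)^', W (diff_quotient f x v t).
    exact: Df nW.
  apply: filterS2 nT nD => t Tt Wt t0.
  have := TWN (t, diff_quotient f x v t) (conj Tt (Wt t0)) t0.
  by rewrite /preimage /diff_quotient /= scalerA divff// scale1r subrKC.
- move=> x v Ax.
  apply: (@continuous_comp _ _ _ (fun z : V * V => (f z.1, df z.1 z.2))
    (fun w : U * U => dg w.1 w.2)); last by apply: Cg; exact: fAB.
  have cf1 : {for (x, v), continuous (f \o @fst V V)}.
    by apply: continuous_comp; [exact: cvg_fst | apply: cf; rewrite inE].
  by apply: cvg_pair => /=; [exact: cf1 | exact: Cf].
- move=> x Ax a u v; rewrite Lf// Lg//; exact: fAB.
Qed.

Lemma holomorphic_on_linear {R : realType} {V F : tvsType R[i]} (f : V -> F) :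
  linear f -> continuous f -> holomorphic_on setT f.
Proof.
move=> lf cf; apply/holomorphic_onP; first exact: openT.
split; first by move=> x _; exact: cf.
exists (fun=> f); split => //.
- move=> x v _ N /nbhs_singleton Nfv.
  have quotE t : t != 0 -> diff_quotient f x v t = f v.
    move=> t0; rewrite /diff_quotient [x + _]addrC lf addrK.
    by rewrite scalerA mulVf// scale1r.
  suff : \forall t \near (0 : R[i]^o)^', N (diff_quotient f x v t) by [].
  by apply: filterS (@filterT _ (nbhs (0 : R[i]^o)) _) => t _ t0; rewrite quotE.
- move=> x v _; apply: (@continuous_comp _ _ _ snd f); last exact: cf.
  exact: cvg_snd.
Qed.

(** * Coinduction *)

Lemma ptws_continuousP {T X : topologicalType} {I : eqType} (f : T -> I -> X) :
  continuous (f : T -> {ptws I -> X}) <-> forall i, continuous (fun x => f x i).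
Proof.
split=> [cf i x|cf x].
  have ci := @proj_continuous I (fun=> X) i (f x).
  exact: (@continuous_comp _ _ _ _ _ x (cf x) ci).
apply/cvg_sup => i.
have ci : continuous (f : T -> initial_topology (fun h : I -> X => h i)).
  exact: continuous_comp_initial (cf i).
exact: ci x.
Qed.

Section Coinduction.
Context {R : realType} {V : completeNormedModType R[i]}
  {G : complexBanachLieGroupType V}.
Implicit Types (P : set G) (W E : tvsType R[i]).

Local Open Scope group_scope.

Lemma lie_subgroup_inv P p : complex_lie_subgroup P -> P p -> P p^-1.
Proof. by move=> [P1 PV _] Pp; rewrite -[p^-1]mul1g; exact: PV. Qed.

(** In a chart [a], inversion is holomorphic only where the inverse lies in the
    domain of the target chart [c], which must be chosen near each point; this
    is why the composite has to be glued from local pieces. *)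
Lemma holomorphic_fun_inv W (f : G -> W) :
  holomorphic_fun f -> holomorphic_fun (fun g => f g^-1).
Proof.
move=> hf a Ha; have oa : open (chart_img a) by exact: chart_img_open.
apply: holomorphic_on_local => // x ax.
have [c Hc cx] := lie_atlas_cover (chart_inv a x)^-1.
exists [set y | chart_img a y /\ chart_dom c (chart_inv a y)^-1].
exists ((f \o chart_inv c) \o (fun y => c (chart_inv a y)^-1)).
have oB : open [set y | chart_img a y /\ chart_dom c (chart_inv a y)^-1].
  have [+ _] := continuous_inP (fun y => (chart_inv a y)^-1) oa.
  apply; last exact: chart_dom_open.
  move=> y ay; apply: (@continuous_comp _ _ _ (chart_inv a) (fun g : G => g^-1));
    last exact: lie_inv_continuous.
  have := @chart_inv_continuous _ _ _ a.
  by rewrite continuous_open_subspace; [exact | exact: chart_img_open].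
split => //.
- apply: (@holomorphic_on_comp _ _ _ _ _ (chart_img c)) => //.
  + exact: chart_img_open.
  + by move=> y [_ cy]; exists (chart_inv a y)^-1.
  + exact: lie_inv_holomorphic.
  + exact: hf.
- by move=> y [_ cy] /=; rewrite chart_mapK.
Qed.

Lemma holomorphic_fun_linear W E (f : G -> W) (beta : W -> E) :
  linear beta -> continuous beta -> holomorphic_fun f ->
  holomorphic_fun (beta \o f).
Proof.
move=> lb cb hf a Ha; rewrite -compA.
apply: (@holomorphic_on_comp _ _ _ _ _ setT) => //.
- exact: chart_img_open.
- exact: openT.
- exact: hf.
- exact: holomorphic_on_linear.
Qed.

Lemma coinduce_Hom_G P W E (pi : G -> W -> W) (rho : G -> E -> E)
    (beta : W -> E) :
  complex_lie_subgroup P -> representation setT pi ->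
  (forall w, holomorphic_fun (fun g => pi g w)) ->
  Hom_P P pi rho beta -> Hom_G P pi rho (coinduce pi beta).
Proof.
move=> hP [pilc pi1 piM] pihol [lb cb bP]; split.
- move=> w; split.
    apply: (holomorphic_fun_linear lb cb (f := fun g => pi g^-1 w)).
    exact: (holomorphic_fun_inv (pihol w)).
  move=> g p Pp; rewrite /coinduce invgM piM// bP//; exact: lie_subgroup_inv.
- by move=> a u v; apply/funext => g; rewrite /coinduce (pilc g^-1 I).1 lb.
- apply/ptws_continuousP => g w.
  by apply: continuous_comp; [exact: (pilc g^-1 I).2 | exact: cb].
- move=> g w; apply/funext => x.
  by rewrite /translate /coinduce invgM invgK piM.
Qed.

Lemma ev1_Hom_P P W E (pi : G -> W -> W) (rho : G -> E -> E)
    (phi : W -> G -> E) :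
  complex_lie_subgroup P ->
  Hom_G P pi rho phi -> Hom_P P pi rho (ev1 phi).
Proof.
move=> hP [phiO lphi cphi phiG]; split.
- by move=> a u v; rewrite /ev1 lphi.
- exact: (ptws_continuousP _).1 cphi 1.
- move=> p w Pp; rewrite /ev1 phiG /translate mulg1 -[p^-1]mul1g.
  by rewrite (phiO w).2 ?invgK//; exact: lie_subgroup_inv.
Qed.

(** Every value [phi w g] is a value at [1] of a translate of [phi w]. *)
Lemma coinduceK P W E (pi : G -> W -> W) (rho : G -> E -> E)
    (phi : W -> G -> E) :
  Hom_G P pi rho phi -> coinduce pi (ev1 phi) = phi.
Proof.
move=> [_ _ _ phiG]; apply/funext => w; apply/funext => g.
by rewrite /coinduce /ev1 phiG /translate invgK mulg1.
Qed.

Lemma ev1_coinduce W E (pi : G -> W -> W) (beta : W -> E) :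
  representation setT pi -> ev1 (coinduce pi beta) = beta.
Proof.
by move=> [_ pi1 _]; apply/funext => w; rewrite /ev1 /coinduce invg1 pi1.
Qed.

End Coinduction.

Unset Implicit Arguments.

Theorem theoremA1 (R : realType) (V : completeNormedModType R[i])
    (G : complexBanachLieGroupType V) (P : set G)
    (W E : tvsType R[i]) (pi : G -> W -> W) (rho : G -> E -> E)
    (hP : complex_lie_subgroup P)
    (hpi : representation setT pi)
    (hpi_hol : forall w : W, holomorphic_fun (fun g => pi g w))
    (hrho : representation P rho)
    (hrho_hol : forall v : E, holomorphic_fun_on P (fun p => rho p v)) :
  [/\ set_bij (Hom_G P pi rho) (Hom_P P pi rho) (@ev1 R V G W E),
      set_fun (Hom_P P pi rho) (Hom_G P pi rho) (coinduce pi),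
      forall phi, Hom_G P pi rho phi -> coinduce pi (ev1 phi) = phi
    & forall beta, Hom_P P pi rho beta -> ev1 (coinduce pi beta) = beta].
Proof.
have GP phi : Hom_G P pi rho phi -> Hom_P P pi rho (ev1 phi).
  exact: ev1_Hom_P.
have PG beta : Hom_P P pi rho beta -> Hom_G P pi rho (coinduce pi beta).
  exact: coinduce_Hom_G.
have ev1K phi : Hom_G P pi rho phi -> coinduce pi (ev1 phi) = phi.
  exact: coinduceK.
have coindK beta : ev1 (coinduce pi beta) = beta by exact: ev1_coinduce.
split => //; split => //.
- move=> phi psi /set_mem Gphi /set_mem Gpsi eq_ev.
  by rewrite -(ev1K _ Gphi) eq_ev ev1K.
- by move=> beta Pbeta; exists (coinduce pi beta); [exact: PG | exact: coindK].
Qed.
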